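(* Let $\mathbb{F}$ be a definite field and let $A$ and $B$ be positive definite (square) matrices over $\mathbb{F}$. Then the Kronecker product $A\otimes B$ is positive definite. In fact, if $A=LL^T$ and $B=MM^T$ (with $L$, $M$ square matrices over $\mathbb{F}$ of the same sizes as $A$, $B$ respectively), then $A\otimes B=(L\otimes M)(L\otimes M)^T$.
   Context: An element $x$ of a field $\mathbb{F}$ is called positive if $x=\mu^2$ for some non-zero $\mu\in\mathbb{F}$; then $\mu$ is a square root of $x$, and it is a positive square root if $\mu$ is itself positive. A field is a definite field if each of its positive elements has a positive square root in it. A symmetric $n\times n$ matrix $A$ over a definite field $\mathbb{F}$ has a Cholesky decomposition if $A=LL^T$ for some lower triangular $n\times n$ matrix $L$ over $\mathbb{F}$ all of whose diagonal entries are positive; $A$ is positive definite if it is symmetric and has a Cholesky decomposition. *)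

(* Defs.v *)
From mathcomp Require Import all_boot all_algebra.

Set Implicit Arguments.
Unset Strict Implicit.
Unset Printing Implicit Defensive.

Import GRing.Theory.
Local Open Scope ring_scope.

(* No order is assumed on F: positivity is the algebraic notion of being a
   non-zero square. *)
Definition is_positive (F : fieldType) (x : F) : Prop :=
  exists mu : F, mu != 0 /\ x = mu ^+ 2.

Definition definite_field (F : fieldType) : Prop :=
  forall x : F, is_positive x -> exists mu : F, is_positive mu /\ x = mu ^+ 2.

(* is_trig_mx is lower triangularity: L i j = 0 whenever i < j. *)
Definition has_cholesky (F : fieldType) (n : nat) (A : 'M[F]_n) : Prop :=
  exists L : 'M[F]_n,
    [/\ is_trig_mx L, forall i, is_positive (L i i) & A = L *m L^T].

Definition positive_definite (F : fieldType) (n : nat) (A : 'M[F]_n) : Prop :=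
  A^T = A /\ has_cholesky A.

(* Main.v *)
Require Import Defs.
From mathcomp Require Import all_boot all_algebra.
From mathcomp.real_closed Require Import mxtens.
Import GRing.Theory.
Local Open Scope ring_scope.

(** Transposition distributes over the Kronecker product and
    (L *t M) *m (P *t Q) = (L *m P) *t (M *m Q), so factorisations A = L L^T
    and B = M M^T tensor to A *t B = (L *t M) (L *t M)^T. This is a Cholesky
    decomposition as soon as L and M provide ones: the index (i, j) is encoded
    as i * n + j, which is the lexicographic order, so a Kronecker product of
    lower triangular matrices is lower triangular ([tensmx_is_trig]); and its
    diagonal entries are the products of diagonal entries of L and M, which
    are positive because non-zero squares are closed under multiplication
    ([is_positiveM]). *)

Lemma is_positiveM (F : fieldType) (x y : F) :
  is_positive x -> is_positive y -> is_positive (x * y).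
Proof.
move=> [a [a0 ->]] [b [b0 ->]]; exists (a * b).
by rewrite mulf_neq0 // exprMn.
Qed.

(** If k < l, the lexicographic order leaves two cases: either the first
    components already satisfy k %/ n < l %/ n, and the factor from L
    vanishes, or they agree and k %% n < l %% n, and the factor from M does. *)
Lemma tensmx_is_trig (R : pzRingType) (m n : nat) (L : 'M[R]_m) (M : 'M[R]_n) :
  is_trig_mx L -> is_trig_mx M -> is_trig_mx (L *t M).
Proof.
move=> /is_trig_mxP trigL /is_trig_mxP trigM; apply/is_trig_mxP => k l ltkl.
rewrite mxE; have := leq_div2r n (ltnW ltkl); rewrite leq_eqVlt.
case/orP=> [/eqP eq_div | lt_div]; last by rewrite trigL ?mul0r.
rewrite [M _ _]trigM ?mulr0 //=.
by move: ltkl; rewrite {1}(divn_eq k n) {1}(divn_eq l n) eq_div ltn_add2l.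
Qed.

Lemma tensmx_mul_tr (R : comPzRingType) (m n p q : nat)
  (L : 'M[R]_(m, n)) (M : 'M[R]_(p, q)) :
  (L *m L^T) *t (M *m M^T) = (L *t M) *m (L *t M)^T.
Proof. by rewrite trmx_tens tensmx_mul. Qed.

Lemma tensmx_has_cholesky (F : fieldType) (m n : nat)
  (A : 'M[F]_m) (B : 'M[F]_n) :
  has_cholesky A -> has_cholesky B -> has_cholesky (A *t B).
Proof.
move=> [L [trigL posL ->]] [M [trigM posM ->]]; exists (L *t M).
split; [exact: tensmx_is_trig | | exact: tensmx_mul_tr].
by move=> k; rewrite mxE; apply: is_positiveM.
Qed.

Theorem theorem9 (F : fieldType) (hF : definite_field F) (m n : nat)
  (A : 'M[F]_m) (B : 'M[F]_n)
  (hA : positive_definite A) (hB : positive_definite B) :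
  positive_definite (A *t B) /\
  (forall (L : 'M[F]_m) (M : 'M[F]_n),
     A = L *m L^T -> B = M *m M^T ->
     A *t B = (L *t M) *m (L *t M)^T).
Proof.
case: hA hB => [symA cholA] [symB cholB]; split; last first.
  by move=> L M -> ->; apply: tensmx_mul_tr.
split; first by rewrite trmx_tens symA symB.
exact: tensmx_has_cholesky.
Qed.
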